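(* Let $\mathcal{P}$ be the set of all primes and let $\mathcal{P}'\subseteq\mathcal{P}$ be the set of primes $p$ for which there exist an algebraically closed field $\Bbbk$ of characteristic $p$ and a representation $\rho$ of $\mathfrak{sl}_2=\mathfrak{sl}_2(\Bbbk)$ on a $\Bbbk$-vector space $V$ such that the semidirect product Lie algebra $L:=V\rtimes\mathfrak{sl}_2$ satisfies $$\kappa_L\equiv 0\quad\text{and}\quad \dim_{\Bbbk} L<p,$$ where $\kappa_L$ is the Killing form of $L$. Then there is a subset $\mathcal{P}''\subseteq\mathcal{P}'$ whose density $d(\mathcal{P}'')$ exists and satisfies $$d(\mathcal{P}'')\ \ge\ \frac{1}{\inf_{n\in 2\mathbb{Z}_{\ge 1}+1}\varphi\left(\frac{n(2n-1)(2n+1)}{3}\right)},$$ where $\varphi$ is the Euler totient function and $n$ ranges over the odd integers $\ge 3$.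
   Context: For a set $\mathcal{Q}$ of primes, its density is $d(\mathcal{Q}):=\lim_{s\searrow 1}\frac{\sum_{p\in\mathcal{Q}}p^{-s}}{\log\frac{1}{s-1}}$, if the limit exists. For a representation $\rho$ of a Lie algebra $\mathfrak{g}$ on $V$, the semidirect product $V\rtimes\mathfrak{g}$ is the Lie algebra $V\oplus\mathfrak{g}$ in which $V$ is an abelian ideal, $\mathfrak{g}$ is a subalgebra, and $[x,v]=\rho(x)v$ for $x\in\mathfrak{g}$, $v\in V$. The Killing form of a finite-dimensional Lie algebra $L$ is $\kappa_L(x,y)=\mathrm{Tr}(\mathrm{ad}_L(x)\,\mathrm{ad}_L(y))$. *)

(* Defs.v *)
From HB Require Import structures.
From mathcomp Require Import all_boot all_order all_algebra.
From mathcomp Require Import ring.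
From mathcomp Require Import all_classical all_reals all_analysis.
Import Order.TTheory GRing.Theory Num.Theory.
Import numFieldNormedType.Exports.

Set Implicit Arguments.
Unset Strict Implicit.
Unset Printing Implicit Defensive.

Local Open Scope classical_set_scope.
Local Open Scope ring_scope.

HB.mixin Record hasLieBracket (K : fieldType) L of Vector K L := {
  lie : L -> L -> L;
  lie_linearl : forall y, linear (lie^~ y);
  lie_linearr : forall x, linear (lie x);
  liexx : forall x, lie x x = 0;
  lie_jacobi : forall x y z,
    lie x (lie y z) + lie y (lie z x) + lie z (lie x y) = 0
}.

(* Finite-dimensional Lie algebras over K (a vectType is finite-dimensional). *)
#[short(type="finLieAlgType")]
HB.structure Definition FinLieAlgebra (K : fieldType) :=
  {L of hasLieBracket K L & Vector K L}.

Notation "[ 'lie' x , y ]" := (lie x y)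
  (at level 0, x at level 99, y at level 99, format "[ 'lie'  x ,  y ]")
  : ring_scope.

Section LieBracketTheory.
Variables (K : fieldType) (L : finLieAlgType K).
Implicit Types x y z : L.

HB.instance Definition _ x := GRing.isSemilinear.Build K L L *:%R (@lie K L x)
  (GRing.semilinear_linear (lie_linearr x)).

Lemma lieDl x1 x2 y : [lie x1 + x2, y] = [lie x1, y] + [lie x2, y].
Proof. by have := lie_linearl y 1 x1 x2; rewrite /= !scale1r. Qed.

Lemma lieC x y : [lie x, y] = - [lie y, x].
Proof.
apply/eqP; rewrite -addr_eq0; have := liexx (x + y).
by rewrite lieDl !raddfD /= !liexx add0r addr0 => ->.
Qed.

End LieBracketTheory.

Definition adj (K : fieldType) (L : finLieAlgType K) (x : L) : 'End(L) :=
  linfun (lie x).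

Definition lfun_trace (K : fieldType) (V : vectType K) (f : 'End(V)) : K :=
  \tr (passmx.mxof (vbasis {:V}) (vbasis {:V}) f).

Definition killing (K : fieldType) (L : finLieAlgType K) (x y : L) : K :=
  lfun_trace (adj x \o adj y)%VF.

Record lieRepr (K : fieldType) (g : finLieAlgType K) (V : vectType K) :=
  LieRepr {
    lieRepr_map :> {linear g -> 'End(V)};
    lieRepr_lie : forall x y : g, lieRepr_map [lie x, y] =
      (lieRepr_map x \o lieRepr_map y)%VF - (lieRepr_map y \o lieRepr_map x)%VF
  }.

Definition sdprod (K : fieldType) (g : finLieAlgType K) (V : vectType K)
  (rho : lieRepr g V) : Type := (V * g)%type.

Section SemidirectProduct.
Variables (K : fieldType) (g : finLieAlgType K) (V : vectType K).
Variable rho : lieRepr g V.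

HB.instance Definition _ := Vector.copy (sdprod rho) (V * g)%type.

Definition sdprod_lie (a b : sdprod rho) : sdprod rho :=
  (rho a.2 b.1 - rho b.2 a.1, [lie a.2, b.2]).

Fact sdprod_lie_linearr a : linear (sdprod_lie a).
Proof.
move=> c [v x] [w y]; congr pair; last exact: linearP.
rewrite /= !linearP /= add_lfunE scale_lfunE scalerBr opprD.
by rewrite addrACA.
Qed.

Fact sdprod_lieC a b : sdprod_lie a b = - sdprod_lie b a.
Proof. by congr pair; [rewrite /= opprB | rewrite /= lieC]. Qed.

Fact sdprod_lie_linearl b : linear (sdprod_lie^~ b).
Proof.
move=> c u v; rewrite sdprod_lieC sdprod_lie_linearr opprD -scalerN.
by rewrite -!sdprod_lieC.
Qed.

Fact sdprod_liexx a : sdprod_lie a a = 0.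
Proof. by congr pair; rewrite /= ?subrr ?liexx. Qed.

Fact sdprod_jacobi a b c :
  sdprod_lie a (sdprod_lie b c) + sdprod_lie b (sdprod_lie c a)
    + sdprod_lie c (sdprod_lie a b) = 0.
Proof.
case: a b c => [u x] [v y] [w z]; congr pair; last exact: lie_jacobi.
rewrite /= !lieRepr_lie !linearB /= !add_lfunE !opp_lfunE !comp_lfunE.
move: (rho x (rho y w)) (rho x (rho z v)) (rho y (rho x w)) => A B C.
move: (rho y (rho z u)) (rho z (rho x v)) (rho z (rho y u)) => D E F.
rewrite !opprB !addrA (ACl (1*12*7*2*11*6*5*4*9*8*3*10)) /=.
by rewrite subrr !(add0r, subrr, addrN).
Qed.

HB.instance Definition _ := hasLieBracket.Build K (sdprod rho)
  sdprod_lie_linearl sdprod_lie_linearr sdprod_liexx sdprod_jacobi.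

End SemidirectProduct.

Definition sl2_space (K : fieldType) : {vspace 'M[K]_2} :=
  lker (linfun (@mxtrace K 2 : 'M[K]_2 -> K^o)).

Definition sl2 (K : fieldType) : Type := subvs_of (sl2_space K).

Section SL2.
Variable K : fieldType.

HB.instance Definition _ := Vector.copy (sl2 K) (subvs_of (sl2_space K)).

Definition mx_comm (A B : 'M[K]_2) : 'M[K]_2 := A *m B - B *m A.

Lemma mem_sl2 (A : 'M[K]_2) : (A \in sl2_space K) = (\tr A == 0).
Proof. by rewrite memv_ker lfunE. Qed.

Lemma mx_comm_sl2 A B : mx_comm A B \in sl2_space K.
Proof. by rewrite mem_sl2 linearB /= mxtrace_mulC subrr. Qed.

Definition sl2_lie (x y : sl2 K) : sl2 K :=
  Subvs (mx_comm_sl2 (vsval x) (vsval y)).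

Fact sl2_lieC x y : sl2_lie x y = - sl2_lie y x.
Proof. by apply/val_inj; rewrite /= /mx_comm opprB. Qed.

Fact sl2_lie_linearr x : linear (sl2_lie x).
Proof.
move=> c u v; apply/val_inj; rewrite /= /mx_comm.
by rewrite mulmxDr mulmxDl -scalemxAr -scalemxAl scalerBr opprD addrACA.
Qed.

Fact sl2_lie_linearl y : linear (sl2_lie^~ y).
Proof.
move=> c u v; rewrite sl2_lieC sl2_lie_linearr opprD -scalerN.
by rewrite -!sl2_lieC.
Qed.

Fact sl2_liexx x : sl2_lie x x = 0.
Proof. by apply/val_inj; rewrite /= /mx_comm subrr. Qed.

Fact sl2_jacobi x y z :
  sl2_lie x (sl2_lie y z) + sl2_lie y (sl2_lie z x)
    + sl2_lie z (sl2_lie x y) = 0.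
Proof.
apply/val_inj; rewrite /= /mx_comm !mulmxBl !mulmxBr !mulmxA.
move: (vsval x) (vsval y) (vsval z) => A B C.
move: (A *m B *m C) (A *m C *m B) (B *m A *m C) => a b c.
move: (B *m C *m A) (C *m A *m B) (C *m B *m A) => d e f.
rewrite !opprB !addrA.
by apply/matrixP => i j; rewrite !mxE; ring.
Qed.

HB.instance Definition _ := hasLieBracket.Build K (sl2 K)
  sl2_lie_linearl sl2_lie_linearr sl2_liexx sl2_jacobi.

End SL2.

Definition primes_sl2 : set nat := [set p | prime p /\
  exists (k : closedFieldType) (V : vectType k) (rho : lieRepr (sl2 k) V),
    [/\ p \in [pchar k],
        forall x y : sdprod rho, killing x y = 0 &
        (\dim {:sdprod rho} < p)%N]].

Definition density_quotient (R : realType) (Q : set nat) (s : R) : R :=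
  limn (fun n => \sum_(0 <= p < n | p \in Q) (p%:R : R) `^ (- s))
  / ln (1 / (s - 1)).

Definition has_density (R : realType) (Q : set nat) : Prop :=
  cvg (density_quotient Q s @[s --> (1 : R)^'+]).

Definition density (R : realType) (Q : set nat) : R :=
  lim (density_quotient Q s @[s --> (1 : R)^'+]).

(* Main.v *)
Require Import Defs.
From HB Require Import structures.
From mathcomp Require Import all_boot all_order all_algebra closed_field.
From mathcomp Require Import ring lra zify.
From mathcomp Require Import all_classical all_reals all_analysis.
Import Order.TTheory GRing.Theory Num.Theory.
Import numFieldNormedType.Exports.
Import passmx.

(** Much more holds than is claimed: every prime p >= 19 lies in P', so P''
may be taken to be the set of these primes, and its density is 1. The right
hand side is at most 1 because every totient in the infimum is at least 1.

Why p >= 19 suffices. Write (x, y) = tr(xy) for the trace form of the standard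
representation of sl_2. The Killing form of sl_2 is 4 (x, y), and the Killing
form of V x| g is the Killing form of g plus the trace form of V, since V is an
abelian ideal ([killing_sdprod]). Hence, for V the sum of a copies of the
adjoint and r copies of the standard representation, the Killing form of
V x| sl_2 is (4 + 4a + r) (x, y), while the dimension is 3 + 3a + 2r. Dividing
p - 4 by 4 gives a quotient a and a remainder r <= 3 with p = 4 + 4a + r, so the
Killing form vanishes in characteristic p; and 3 + 3a + 2r < p amounts to
r <= a, which holds as soon as a >= 3.

Why the density is 1. As s decreases to 1, the sum of p^-s over all primes stays
within a bounded distance of log (1 / (s - 1)), and removing finitely many
primes changes it by a bounded amount. For the comparison, integral-type
telescoping gives 1 / (s - 1) <= zeta(s) <= 1 + 1 / (s - 1), and the Euler
product is obtained by sieving: the sum of n^-s over the n without prime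
factor below q equals zeta(s) times the product of the 1 - p^-s for p < q
([rough_sum_prod]), it is at least 1 because of n = 1, and at most 2 for large
q because only n = 1 and the tail n >= q contribute. Taking logarithms turns
these two bounds into the upper and the lower estimate of the prime sum. *)

Set Implicit Arguments.
Unset Strict Implicit.
Unset Printing Implicit Defensive.

Local Open Scope classical_set_scope.
Local Open Scope ring_scope.

(** * Traces of endomorphisms *)

Section Trace.
Variable K : fieldType.
Implicit Types U V W : vectType K.

Lemma linfunE V W (f : V -> W) : linear f -> linfun f =1 f.
Proof.
move=> fP v; pose f' := HB.pack_for {linear V -> W} f
  (GRing.isSemilinear.Build _ _ _ _ _ (GRing.semilinear_linear fP)).
exact: (lfunE f').
Qed.

Lemma lfun_traceC V W (f : 'Hom(V, W)) (g : 'Hom(W, V)) :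
  lfun_trace (f \o g)%VF = lfun_trace (g \o f)%VF.
Proof.
rewrite /lfun_trace.
rewrite (mxof_comp (vbasis {:W}) (vbasis {:W}) (vbasisP {:V})).
rewrite (mxof_comp (vbasis {:V}) (vbasis {:V}) (vbasisP {:W})).
exact: mxtrace_mulC.
Qed.

Lemma lfun_traceD V (f g : 'End(V)) :
  lfun_trace (f + g) = lfun_trace f + lfun_trace g.
Proof. by rewrite /lfun_trace !linearD. Qed.

Lemma lfun_trace_sum V (I : finType) (f : I -> 'End(V)) :
  lfun_trace (\sum_i f i) = \sum_i lfun_trace (f i).
Proof. by rewrite /lfun_trace !linear_sum. Qed.

Lemma lfun_trace_line (f : 'End(K^o)) : lfun_trace f = f 1.
Proof.
have -> : f = f 1 *: \1%VF.
  apply/lfunP=> x; rewrite scale_lfunE id_lfunE.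
  by rewrite -[in LHS](mulr1 x) -[x * 1]/(x *: (1 : K^o)) linearZ; apply: mulrC.
rewrite scale_lfunE id_lfunE /lfun_trace !linearZ /= mxof1.
  by rewrite mxtrace1 dimvf /=.
exact: basis_free (vbasisP _).
Qed.

(** The identity is the sum of the rank one maps [v |-> c i v *: e i], so
cyclicity reduces the trace to traces on the one-dimensional space [K^o]. The
family [e] need only span compatibly with [c]: it may be redundant. *)
Lemma lfun_trace_coord V (I : finType) (e : I -> V) (c : I -> V -> K^o)
    (f : 'End(V)) :
  (forall i, linear (c i)) -> (forall v, v = \sum_i c i v *: e i) ->
  lfun_trace f = \sum_i c i (f (e i)).
Proof.
move=> cP vE; pose E i : 'Hom(K^o, V) := linfun (fun k : K^o => k *: e i).
have EE i : E i =1 fun k : K^o => k *: e i.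
  by apply: linfunE => k u v; rewrite scalerDl -scalerA.
have fE : f = \sum_i ((f \o E i) \o linfun (c i))%VF.
  apply/lfunP=> v; rewrite [in LHS](vE v) linear_sum sum_lfunE.
  by apply: eq_bigr => i _; rewrite !comp_lfunE (linfunE (cP i)) EE.
rewrite [in LHS]fE lfun_trace_sum; apply: eq_bigr => i _.
rewrite lfun_traceC lfun_trace_line !comp_lfunE (linfunE (cP i)) EE /=.
by rewrite scale1r.
Qed.

(** Only the two diagonal blocks of [f] matter; this also covers the block
triangular operators produced by an ideal. *)
Lemma lfun_trace_pair V W (f : 'End((V * W)%type)) (g : 'End(V)) (h : 'End(W)) :
  (forall v, (f (v, 0)).1 = g v) -> (forall w, (f (0, w)).2 = h w) ->
  lfun_trace f = lfun_trace g + lfun_trace h.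
Proof.
move=> fg fh.
pose i1 : 'Hom(V, (V * W)%type) := linfun (fun v : V => (v, 0)).
pose i2 : 'Hom(W, (V * W)%type) := linfun (fun w : W => (0, w)).
have i1E : i1 =1 fun v => (v, 0).
  by apply: linfunE => k u v; congr pair; rewrite /= ?scaler0 ?addr0.
have i2E : i2 =1 fun w => (0, w).
  by apply: linfunE => k u v; congr pair; rewrite /= ?scaler0 ?addr0.
pose p1 : 'Hom((V * W)%type, V) := linfun fst.
pose p2 : 'Hom((V * W)%type, W) := linfun snd.
have -> : f = (((f \o i1) \o p1) + ((f \o i2) \o p2))%VF.
  apply/lfunP=> -[v w]; rewrite add_lfunE !comp_lfunE !lfunE i1E i2E /=.
  by rewrite -linearD; congr (f _); congr pair; rewrite /= ?addr0 ?add0r.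
rewrite lfun_traceD lfun_traceC [X in _ + X]lfun_traceC.
congr (_ + _); congr lfun_trace; apply/lfunP=> x; rewrite !comp_lfunE lfunE /=.
  by rewrite i1E fg.
by rewrite i2E fh.
Qed.

Lemma dim_pair V W : \dim {:(V * W)%type} = (\dim {:V} + \dim {:W})%N.
Proof. by rewrite !dimvf. Qed.

End Trace.

(** * Sums of representations and Killing forms of semidirect products *)

Section Representations.
Variables (K : fieldType) (g : finLieAlgType K).

Section DirectSum.
Variables (V W : vectType K) (rho : lieRepr g V) (sigma : lieRepr g W).

Let act (x : g) (v : V * W) : V * W := (rho x v.1, sigma x v.2).

Fact dsum_act_linear x : linear (act x).
Proof. by move=> k u v; congr pair; rewrite /= linearP. Qed.

Definition dsum_map (x : g) : 'End((V * W)%type) := linfun (act x).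

Let dsum_mapE x : dsum_map x =1 act x := linfunE (dsum_act_linear x).

Fact dsum_map_linear : linear dsum_map.
Proof.
move=> k x y; apply/lfunP=> v; rewrite add_lfunE scale_lfunE !dsum_mapE /= /act.
by congr pair; rewrite !linearP /= add_lfunE scale_lfunE.
Qed.
HB.instance Definition _ := GRing.isSemilinear.Build K _ _ *:%R dsum_map
  (GRing.semilinear_linear dsum_map_linear).

Fact dsum_map_lie x y : dsum_map [lie x, y] =
  (dsum_map x \o dsum_map y)%VF - (dsum_map y \o dsum_map x)%VF.
Proof.
apply/lfunP=> v; rewrite add_lfunE opp_lfunE !comp_lfunE !dsum_mapE /= /act.
by congr pair; rewrite lieRepr_lie add_lfunE opp_lfunE !comp_lfunE.
Qed.

Definition lieRepr_dsum : lieRepr g (V * W)%type := LieRepr dsum_map_lie.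

Lemma trace_dsum x y :
  lfun_trace (lieRepr_dsum x \o lieRepr_dsum y)%VF =
  lfun_trace (rho x \o rho y)%VF + lfun_trace (sigma x \o sigma y)%VF.
Proof.
by apply: lfun_trace_pair => v; rewrite !comp_lfunE !dsum_mapE.
Qed.

End DirectSum.

Fact adj_linear : linear (@adj K g).
Proof.
move=> k x y; apply/lfunP=> z; rewrite add_lfunE scale_lfunE !lfunE.
exact: lie_linearl.
Qed.
HB.instance Definition _ := GRing.isSemilinear.Build K _ _ *:%R (@adj K g)
  (GRing.semilinear_linear adj_linear).

Fact adj_lie (x y : g) :
  adj [lie x, y] = (adj x \o adj y)%VF - (adj y \o adj x)%VF.
Proof.
apply/lfunP=> z; rewrite add_lfunE opp_lfunE !comp_lfunE !lfunE /=.
apply/eqP; rewrite lieC -subr_eq0 -oppr_eq0 -(lie_jacobi x y z).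
rewrite [lie y (lie z x)]/= [ [lie z, x] ]lieC linearN /=.
by rewrite opprB opprK addrC addrA.
Qed.

Definition lieRepr_adj : lieRepr g g := LieRepr adj_lie.

(** The operator [ad a \o ad b] preserves the ideal [V] and acts there through
the [g]-components only, because [V] is abelian. *)
Lemma killing_sdprod (V : vectType K) (rho : lieRepr g V) (a b : sdprod rho) :
  killing a b = lfun_trace (rho a.2 \o rho b.2)%VF + killing a.2 b.2.
Proof.
apply: lfun_trace_pair => v; rewrite !comp_lfunE lfunE /=.
  by rewrite [adj b _]lfunE /= !linear0 !(zero_lfunE, subr0).
by rewrite [adj b _]lfunE /= !lfunE.
Qed.

End Representations.

(** * The adjoint and standard representations of sl2 *)

Section SL2Representations.
Variable K : fieldType.
Implicit Types x y : sl2 K.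

Definition sl2_form x y : K := \tr (vsval x *m vsval y).

Lemma dim_sl2 : \dim {: sl2 K} = 3%N.
Proof.
rewrite dimvf /=.
have := limg_ker_dim (linfun (@mxtrace K 2 : 'M[K]_2 -> K^o)) fullv.
rewrite capfv [in RHS]dimvf /= -/(sl2_space K).
suff -> : (linfun (@mxtrace K 2 : 'M[K]_2 -> K^o) @: fullv)%VS = fullv.
  by rewrite dim_matrix dimvf /= => dimE; apply: (@addIn 1).
apply/vspaceP=> c; rewrite memvf; apply/memv_imgP.
exists (c *: delta_mx 0 0); rewrite ?memvf// lfunE /= mxtraceZ.
by rewrite /mxtrace !big_ord_recl big_ord0 !mxE /= !addr0 mulr1.
Qed.

Let std x (v : 'cV[K]_2) : 'cV[K]_2 := vsval x *m v.

Fact std_linear x : linear (std x).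
Proof. exact: linearP. Qed.

Definition std_map x : 'End('cV[K]_2) := linfun (std x).

Let std_mapE x : std_map x =1 std x := linfunE (std_linear x).

Fact std_map_linear : linear std_map.
Proof.
move=> k x y; apply/lfunP=> v; rewrite add_lfunE scale_lfunE !std_mapE /= /std.
by rewrite linearP /= mulmxDl scalemxAl.
Qed.
HB.instance Definition _ := GRing.isSemilinear.Build K _ _ *:%R std_map
  (GRing.semilinear_linear std_map_linear).

Fact std_map_lie x y : std_map [lie x, y] =
  (std_map x \o std_map y)%VF - (std_map y \o std_map x)%VF.
Proof.
apply/lfunP=> v; rewrite add_lfunE opp_lfunE !comp_lfunE !std_mapE /= /std.
by rewrite mulmxBl !mulmxA.
Qed.

Definition lieRepr_std : lieRepr (sl2 K) 'cV[K]_2 := LieRepr std_map_lie.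

Lemma trace_std x y :
  lfun_trace (lieRepr_std x \o lieRepr_std y)%VF = sl2_form x y.
Proof.
pose c (i : 'I_2) : 'cV[K]_2 -> K^o := fun v => v i 0.
have cP i : linear (c i) by move=> k u v; rewrite /c !mxE.
rewrite (@lfun_trace_coord _ _ _ (fun i => delta_mx i 0) c) => // [|v].
  apply: eq_bigr => i _; rewrite comp_lfunE !std_mapE /= /c /std mulmxA.
  by rewrite -colE mxE.
by rewrite [LHS]matrix_sum_delta; apply: eq_bigr => i _; rewrite big_ord1.
Qed.

Lemma tr_coord (A : 'M[K]_2) :
  \sum_(ij : 'I_2 * 'I_2) A ij.1 ij.2 * \tr (delta_mx ij.1 ij.2 : 'M[K]_2) =
  \tr A.
Proof.
rewrite {2}[A]matrix_sum_delta.
rewrite (pair_bigA _ (fun i j => A i j *: delta_mx i j)) /= linear_sum.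
by apply: eq_bigr => ij _; rewrite linearZ.
Qed.

(** The trace of [X |-> A X B] on 2 x 2 matrices, computed in the basis of
elementary matrices. *)
Lemma tr_sandwich (A B : 'M[K]_2) :
  \sum_(ij : 'I_2 * 'I_2) (A *m delta_mx ij.1 ij.2 *m B) ij.1 ij.2 =
  \tr A * \tr B.
Proof.
rewrite big_distrlr pair_bigA; apply: eq_bigr => -[i j] _ /=.
rewrite -(mul_delta_mx (0 : 'I_1)) mulmxA -colE -mulmxA -rowE.
by rewrite mxE big_ord1 !mxE.
Qed.

(** The trace is computed on all 2 x 2 matrices rather than on a basis of sl2:
the projections to sl2 of the four elementary matrices, with the four matrix
entries as coordinate forms, resolve the identity of sl2. The projection used
is the one along a diagonal elementary matrix, which exists in every
characteristic; the projection along the scalar matrices would fail in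
characteristic 2. *)
Lemma killing_sl2 x y : killing x y = 4%:R * sl2_form x y.
Proof.
have tr0 (v : sl2 K) : \tr (vsval v) = 0 by apply/eqP; rewrite -mem_sl2 subvsP.
pose c (ij : 'I_2 * 'I_2) : sl2 K -> K^o := fun v => vsval v ij.1 ij.2.
have cP ij : linear (c ij) by move=> k u v; rewrite /c linearP !mxE.
pose pr (A : 'M[K]_2) := A - \tr A *: delta_mx 0 0.
have prP A : pr A \in sl2_space K.
  rewrite mem_sl2 linearB linearZ /= /mxtrace !big_ord_recl !big_ord0 !mxE /=.
  by apply/eqP; ring.
pose e (ij : 'I_2 * 'I_2) : sl2 K := Subvs (prP (delta_mx ij.1 ij.2)).
have eE (v : sl2 K) : v = \sum_ij (c ij v : K) *: e ij.
  apply/val_inj; rewrite /= linear_sum /=.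
  transitivity (\sum_ij vsval v ij.1 ij.2 *: pr (delta_mx ij.1 ij.2));
    last by [].
  under eq_bigr do rewrite scalerBr scalerA.
  rewrite sumrB -scaler_suml tr_coord tr0 scale0r subr0.
  rewrite {1}[vsval v]matrix_sum_delta.
  by rewrite (pair_bigA _ (fun i j => vsval v i j *: delta_mx i j)).
rewrite /killing (lfun_trace_coord _ cP eE) /sl2_form.
under eq_bigr do rewrite comp_lfunE !lfunE /c /=.
pose D (A : 'M[K]_2) := mx_comm (vsval x) (mx_comm (vsval y) A).
have DE A : D A = (vsval x *m vsval y) *m A *m 1%:M - vsval x *m A *m vsval y
    - vsval y *m A *m vsval x + 1%:M *m A *m (vsval y *m vsval x).
  rewrite /D /mx_comm mulmx1 mul1mx !(mulmxBl, mulmxBr) !mulmxA.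
  by rewrite opprB addrA addrAC.
have DB A B : D (A - B) = D A - D B.
  by rewrite !DE !(mulmxBl, mulmxBr); apply/matrixP=> i j; rewrite !mxE; ring.
have DZ k A : D (k *: A) = k *: D A.
  by rewrite !DE -!(scalemxAl, scalemxAr) !(scalerBr, scalerDr).
transitivity (\sum_ij D (pr (delta_mx ij.1 ij.2)) ij.1 ij.2); first by [].
(* The correction from the projection is the trace of a commutator. *)
transitivity (\sum_ij D (delta_mx ij.1 ij.2) ij.1 ij.2
              - \tr (D (delta_mx 0 0))).
  rewrite -(tr_coord (D (delta_mx 0 0))) -sumrB; apply: eq_bigr => ij _.
  by rewrite DB DZ !mxE mulrC.
rewrite [\tr (D _)]linearB /= mxtrace_mulC subrr subr0.
have addE (M N : 'M[K]_2) i j : (M + N) i j = M i j + N i j by rewrite mxE.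
have oppE (M : 'M[K]_2) i j : (- M) i j = - M i j by rewrite mxE.
under eq_bigr do rewrite DE !(addE, oppE).
rewrite big_split /= !sumrB !tr_sandwich !tr0 mxtrace1.
by rewrite [\tr (vsval y *m _)]mxtrace_mulC; ring.
Qed.

End SL2Representations.

(** The representation with [a.+1] adjoint and [r] standard summands. *)
Lemma sl2_repr_adj_std (K : fieldType) (a r : nat) :
  exists (V : vectType K) (rho : lieRepr (sl2 K) V),
    \dim {:V} = (3 * a.+1 + 2 * r)%N /\
    forall x y, lfun_trace (rho x \o rho y)%VF =
                (4 * a.+1 + r)%:R * sl2_form x y.
Proof.
elim: r => [|r [V [rho [dimV trV]]]]; last first.
  exists ('cV[K]_2 * V)%type, (lieRepr_dsum (lieRepr_std K) rho); split.
    by rewrite dim_pair dimV dimvf dim_matrix; lia.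
  by move=> x y; rewrite trace_dsum trace_std trV addnS -natr1; ring.
elim: a => [|a [V [rho [dimV trV]]]]; last first.
  exists (sl2 K * V)%type, (lieRepr_dsum (lieRepr_adj (sl2 K)) rho); split.
    by rewrite dim_pair dimV dim_sl2; lia.
  move=> x y; rewrite trace_dsum trV -/(killing x y) killing_sl2.
  by rewrite -mulrDl -natrD; congr (_%:R * _); lia.
exists (sl2 K), (lieRepr_adj (sl2 K)); rewrite dim_sl2; split=> // x y.
by rewrite -/(killing x y) killing_sl2 addn0 muln1.
Qed.

(** Each adjoint summand adds 4 to the coefficient of the trace form for only 3
dimensions, so reaching the coefficient p costs about 3p/4 dimensions; the at
most 3 standard summands correct the residue modulo 4. *)
Lemma primes_sl2_large (p : nat) : prime p -> (19 <= p)%N -> primes_sl2 p.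
Proof.
move=> p_pr p_ge; split=> //.
have [K [FtoK _]] := countable_algebraic_closure 'F_p.
pose r := ((p - 4) %% 4)%N; pose a := ((p - 4) %/ 4).-1.
have pE : (4 + (4 * a.+1 + r))%N = p by rewrite /a /r; lia.
have [V [rho [dimV trV]]] := sl2_repr_adj_std K a r.
have pK : p \in [pchar K] by apply: (rmorph_pchar FtoK); apply: pchar_Fp.
exists K, V, rho; split=> //.
  move=> x y; rewrite killing_sdprod trV killing_sl2 -mulrDl -natrD addnC pE.
  by rewrite (pcharf0 pK) mul0r.
rewrite (dim_pair V (sl2 K)) dimV dim_sl2.
by move: pE; rewrite /a /r; lia.
Qed.

(** * Preliminaries on sums and primes *)

Lemma sumr_multiples (V : nmodType) (F : nat -> V) (P : pred nat) (q N : nat) :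
  (0 < q)%N ->
  \sum_(0 <= n < (q * N)%N | (q %| n)%N && P n) F n =
  \sum_(0 <= m < N | P (q * m)%N) F (q * m)%N.
Proof.
move=> q_gt0; elim: N => [|N IH]; first by rewrite muln0 !big_geq.
rewrite [RHS]big_mkcond big_nat_recr //= -big_mkcond -IH.
rewrite (@big_cat_nat _ _ _ (q * N)%N) //=; last first.
  by rewrite leq_mul2l leqnSn orbT.
congr (_ + _).
have lt_qN : (q * N < q * N.+1)%N by rewrite ltn_pmul2l.
rewrite big_ltn_cond // dvdn_mulr //=.
rewrite big_nat_cond big_pred0 => [|n]; first by rewrite addr0.
apply/negP=> /andP[/andP[ltqN ltqN1] /andP[/dvdnP[k nE] _]].
by move: ltqN ltqN1; rewrite nE [(k * q)%N]mulnC !ltn_pmul2l //; lia.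
Qed.

Definition primorial (q : nat) : nat := \prod_(0 <= p < q | prime p) p.

Lemma primorialS q :
  primorial q.+1 = ((if prime q then q else 1) * primorial q)%N.
Proof. by rewrite /primorial big_mkcond big_nat_recr //= -big_mkcond mulnC. Qed.

Lemma coprime_primorialP n q :
  reflect (forall p, prime p -> (p < q)%N -> ~~ (p %| n)%N)
          (coprime n (primorial q)).
Proof.
apply: (iffP idP) => [n_q p p_pr|].
  elim: q n_q => // q IH; rewrite primorialS coprimeMr => /andP[n_q1 n_q].
  rewrite ltnS leq_eqVlt => /orP[/eqP pq|]; last exact: IH.
  by move: n_q1; rewrite -pq p_pr coprime_sym prime_coprime.
elim: q => [_|q IH n_q]; first by rewrite /primorial big_geq // coprimen1.
rewrite primorialS coprimeMr IH ?andbT => [|p p_pr pq]; last exact/n_q/ltnW.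
case: ifP => [q_pr|_]; last exact: coprimen1.
by rewrite coprime_sym prime_coprime // n_q.
Qed.

(** Since 1/p^2 <= 1/(p - 1) - 1/p, a telescoping sum bounds the sum over all
integers p >= 2. *)
Lemma sum_primes_invsq_le (R : realType) N :
  \sum_(0 <= p < N | prime p) (p%:R^-1 ^+ 2 : R) <= 1.
Proof.
have bound M :
    \sum_(0 <= p < M.+2 | prime p) (p%:R^-1 ^+ 2 : R) <= 1 - M.+1%:R^-1.
  elim: M => [|M IH].
    by rewrite invr1 subrr big_mkcond !big_nat_recr //= big_geq // !addr0.
  have step : M.+2%:R^-1 ^+ 2 <= M.+1%:R^-1 - M.+2%:R^-1 :> R.
    have -> : M.+1%:R^-1 - M.+2%:R^-1 = M.+1%:R^-1 * M.+2%:R^-1 :> R.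
      rewrite -(natr1 M.+1); have := ltr0Sn R M; move: (M.+1%:R : R) => a a_gt0.
      by field; rewrite !gt_eqF // addr_gt0.
    by rewrite expr2 ler_pM2r ?invr_gt0 // lef_pV2 ?posrE // ler_nat.
  rewrite big_mkcond big_nat_recr //= -big_mkcond /=.
  move: IH step; move: (M.+1%:R^-1 : R) (M.+2%:R^-1 : R) => a b IH step.
  by have := sqr_ge0 b; case: ifP => _; lra.
apply: le_trans (_ : _ <= \sum_(0 <= p < N.+2 | prime p) (p%:R^-1 ^+ 2 : R)) _.
  rewrite [leRHS](@big_cat_nat _ _ _ N) //= ?lerDl; last by lia.
  by apply: sumr_ge0 => n _; apply: sqr_ge0.
by apply: le_trans (bound N) _; rewrite gerBl invr_ge0.
Qed.

(** Used for x = p^-s: the factor 1 - x of the Euler product is at least the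
exponential of -x, up to an error 2x^2 whose sum over all primes is bounded. *)
Lemma expRN_le_1B (R : realType) (x : R) :
  0 <= x <= 2^-1 -> expR (- (x + 2 * x ^+ 2)) <= 1 - x.
Proof.
move=> /andP[x0 x1]; rewrite expRN -[leLHS]mul1r ler_pdivrMr ?expR_gt0 //.
apply: (@le_trans _ _ ((1 - x) * (1 + (x + 2 * x ^+ 2)))).
  by nra.
by rewrite ler_wpM2l ?expR_ge1Dx // subr_ge0; lra.
Qed.

Lemma ln2_le1 (R : realType) : ln (2 : R) <= 1.
Proof. by apply: (@le_ln1Dx R 1); rewrite (lt_trans (ltrN10 R)). Qed.

(** * The prime sum near s = 1 *)

Section DirichletSeries.
Variables (R : realType) (s : R).
Hypothesis s_gt1 : 1 < s.
Let t := s - 1.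
Let t_gt0 : 0 < t. Proof. by rewrite subr_gt0. Qed.
Let f (n : nat) : R := n%:R `^ (- s).

Let f_ge0 n : 0 <= f n. Proof. exact: powR_ge0. Qed.

Let f0 : f 0 = 0.
Proof. by rewrite /f powR0 // oppr_eq0 gt_eqF // (lt_trans ltr01). Qed.

Let f1 : f 1 = 1. Proof. by rewrite /f powR1. Qed.

Let fM m n : f (m * n)%N = f m * f n.
Proof. by rewrite /f natrM powRM. Qed.

Let f_leV n : f n <= n%:R^-1.
Proof.
case: n => [|n]; first by rewrite f0 invr0.
rewrite -[leRHS]powR_inv1 // /f ler_powR ?ler1n // lerN2; exact: ltW.
Qed.

Let f_le1 n : f n <= 1.
Proof.
case: n => [|n]; first by rewrite f0.
by apply: (le_trans (f_leV _)); rewrite invf_le1 // ler1n.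
Qed.

Let g (n : nat) : R := n%:R `^ (- t).

Let fE n : (0 < n)%N -> f n = g n / n%:R.
Proof.
move=> n_gt0; rewrite /f /g -[n%:R^-1]powR_inv1 // -powRD.
  by congr (_ `^ _); rewrite /t; ring.
by rewrite pnatr_eq0 -lt0n n_gt0 implybT.
Qed.

Let gE n : (0 < n)%N -> g n = expR (- t * ln n%:R).
Proof. by move=> n_gt0; rewrite /g /powR pnatr_eq0 gtn_eqF. Qed.

Let ln_step n : (0 < n)%N ->
  (n.+1%:R^-1 : R) <= ln n.+1%:R - ln n%:R /\
  ln n.+1%:R - ln n%:R <= (n%:R^-1 : R).
Proof.
move=> n_gt0; have n0 : 0 < n%:R :> R by rewrite ltr0n.
have n1 : 0 < n.+1%:R :> R by rewrite ltr0n.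
split.
  have := @le_ln1Dx R (- n.+1%:R^-1).
  have -> : 1 + - n.+1%:R^-1 = n%:R / n.+1%:R :> R.
    by rewrite -natr1; field; rewrite natr1 gt_eqF.
  rewrite ln_div ?posrE // ltrN2 invf_lt1 // ltr1n => /(_ n_gt0).
  by rewrite lerNr opprB.
have := @le_ln1Dx R (n%:R^-1).
have -> : 1 + n%:R^-1 = n.+1%:R / n%:R :> R.
  by rewrite -natr1; field; rewrite gt_eqF.
rewrite ln_div ?posrE // => -> //.
by apply: (lt_trans (ltrN10 _)); rewrite invr_gt0.
Qed.

(** Comparison of [t n^-(t+1)], where [t = s - 1], with the increments of
[n^-t]: both come from [1 + x <= exp x] applied to [n^-t = exp (- t ln n)]. *)
Let g_step n : (0 < n)%N ->
  t * f n.+1 <= g n - g n.+1 /\ g n - g n.+1 <= t * f n.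
Proof.
move=> n_gt0; have [lo hi] := ln_step n_gt0.
have n0 : 0 < n%:R :> R by rewrite ltr0n.
rewrite !fE // !gE //.
set u := ln n%:R in lo hi *; set v := ln n.+1%:R in lo hi *.
split.
  have -> : - t * u = - t * v + t * (v - u) by ring.
  rewrite expRD -[X in _ - X]mulr1 -mulrBr mulrCA ler_pM2l ?expR_gt0 //.
  by rewrite lerBrDl (le_trans _ (expR_ge1Dx _)) // lerD2l ler_pM2l.
have -> : - t * v = - t * u + - (t * (v - u)) by ring.
rewrite expRD -[X in X - _]mulr1 -mulrBr mulrCA ler_pM2l ?expR_gt0 //.
rewrite lerBlDr -lerBlDl (le_trans _ (expR_ge1Dx _)) //.
by rewrite lerD2l lerN2 ler_pM2l.
Qed.

Let psum (P : pred nat) (N : nat) : R :=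
  \sum_(0 <= n < N | P n) n%:R `^ (- s).

Let psumS P N : psum P N.+1 = psum P N + (if P N then f N else 0).
Proof. by rewrite /psum big_mkcond big_nat_recr //= -big_mkcond. Qed.

(** The sum of [g_step]; the extra [t] in the upper bound is the term n = 1. *)
Let psum_zeta_bounds N :
  1 - g N.+1 <= t * psum xpredT N.+1 /\
  t * psum xpredT N.+2 <= t + 1 - g N.+1.
Proof.
have g1 : g 1 = 1 by rewrite /g powR1.
elim: N => [|N [lo hi]].
  rewrite !psumS /= /psum big_geq // f0 f1 g1 !add0r subrr addrK mulr0 mulr1.
  by [].
have [lo' hi'] := g_step (ltn0Sn N).
rewrite [psum _ N.+3]psumS /=; move: hi lo; rewrite [psum _ N.+2]psumS /=.
rewrite !mulrDr => hi lo.
by split; lra.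
Qed.

Let psum_nd P : nondecreasing_seq (psum P).
Proof.
apply/nondecreasing_seqP=> N; rewrite psumS.
by case: ifP; rewrite ?addr0 ?lerDl.
Qed.

Let psum_sub (P Q : pred nat) N : subpred P Q -> psum P N <= psum Q N.
Proof.
move=> PQ; rewrite /psum big_mkcond [leRHS]big_mkcond; apply: ler_sum => n _.
by case: ifP => [/PQ ->//|_]; case: ifP.
Qed.

Let psum_ub P N : psum P N <= 1 + t^-1.
Proof.
apply: (@le_trans _ _ (psum xpredT N.+2)).
  by apply: le_trans (psum_sub _ _) (psum_nd _ (leqW (leqnSn N))).
have [_] := psum_zeta_bounds N; rewrite -ler_pdivlMl // => /le_trans; apply.
rewrite ler_pdivrMl // mulrDr mulr1 mulfV ?gt_eqF //.
by rewrite lerBlDr lerDl powR_ge0.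
Qed.

Definition dirichlet_sum (P : pred nat) : R :=
  limn (fun N => \sum_(0 <= n < N | P n) n%:R `^ (- s)).

Let psum_cvg P : cvgn (psum P).
Proof.
apply: nondecreasing_is_cvgn; first exact: psum_nd.
by exists (1 + t^-1) => _ [N _ <-]; apply: psum_ub.
Qed.

Let psum_le_lim P N : psum P N <= dirichlet_sum P.
Proof. exact: nondecreasing_cvgn_le (psum_nd P) (@psum_cvg P) N. Qed.

Let lim_psum P c : (forall N, psum P N <= c) -> dirichlet_sum P <= c.
Proof. by move=> le_c; apply: limr_le; [exact: psum_cvg | exact: nearW]. Qed.

Let zeta := dirichlet_sum xpredT.

Lemma zeta_le : zeta <= 1 + t^-1.
Proof. by apply: lim_psum => N; apply: psum_ub. Qed.

(** The partial sums are at least [(1 - N^-t) / t], and [N^-t] becomes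
arbitrarily small. *)
Lemma zeta_ge : t^-1 <= zeta.
Proof.
rewrite -[leLHS]mulr1 ler_pdivrMl //; apply/ler_addgt0Pr => e e_gt0.
(* Any N with (N + 1)^t >= 1/e makes (N + 1)^-t at most e. *)
pose N := Num.truncn (expR (- ln e / t)).
have [lo _] := psum_zeta_bounds N.
have gN : g N.+1 <= e.
  rewrite gE // -[leRHS]lnK ?posrE // ler_expR mulNr lerNl mulrC.
  rewrite -ler_pdivrMr //.
  rewrite -[leLHS]expRK ler_ln ?posrE ?expR_gt0 ?ltr0n //.
  exact/ltW/truncnS_gt.
have : t * psum xpredT N.+1 <= t * zeta by rewrite ler_pM2l.
by move: lo gN; set a := t * _; set b := t * _; lra.
Qed.

Let rough_sum (q : nat) : R := dirichlet_sum (fun n => coprime n (primorial q)).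

Let rough_sum0 : rough_sum 0 = zeta.
Proof.
congr (limn _); apply/funext => N; apply: eq_bigl => n.
by rewrite /primorial big_geq // coprimen1.
Qed.

(** One step of the sieve of Eratosthenes: among the n prime to all primes below
q, the multiples of the prime q are the q m with m of the same kind, and they
contribute q^-s times the whole sum. *)
Let rough_sumS q :
  rough_sum q.+1 = rough_sum q * (if prime q then 1 - f q else 1).
Proof.
case: ifP => [q_pr|q_npr]; last first.
  by rewrite mulr1 /rough_sum primorialS q_npr mul1n.
have q_gt0 := prime_gt0 q_pr.
have qW : coprime q (primorial q).
  apply/coprime_primorialP => p p_pr pq; rewrite dvdn_prime2 //.
  by rewrite neq_ltn pq.
pose P n := coprime n (primorial q); pose P' n := coprime n (primorial q.+1).
have P'E n : P' n = P n && ~~ (q %| n)%N.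
  rewrite /P' primorialS q_pr coprimeMr andbC; congr (_ && _).
  by rewrite coprime_sym prime_coprime.
have sieve N : psum P' (q * N) = psum P (q * N) - f q * psum P N.
  have -> : psum P (q * N) = f q * psum P N + psum P' (q * N).
    rewrite {1}/psum (bigID (fun n => (q %| n)%N)) /=; congr (_ + _).
      under eq_bigl do rewrite andbC.
      rewrite sumr_multiples // /psum mulr_sumr.
      under eq_bigl do rewrite /P coprimeMl qW /=.
      by apply: eq_bigr => n _; rewrite -fM.
    by apply: eq_bigl => n; rewrite P'E.
  by rewrite addrAC subrr add0r.
have cvg_mul (Q : pred nat) :
    psum Q (q * N)%N @[N --> \oo] --> dirichlet_sum Q.
  apply: (@cvg_comp _ _ _ (muln q) (psum Q) _ \oo); first exact: cvg_mulnl.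
  exact: (@psum_cvg Q).
have sieve_lim : psum P' (q * N)%N @[N --> \oo] -->
    dirichlet_sum P - f q * dirichlet_sum P.
  under eq_fun do rewrite sieve.
  apply: cvgB; first exact: cvg_mul.
  by apply: cvgM; [exact: cvg_cst|exact: (@psum_cvg P)].
rewrite /rough_sum -/P' -/P mulrBr mulr1 [X in _ - X]mulrC.
exact: cvg_unique (cvg_mul P') sieve_lim.
Qed.

Let rough_sum_prod q :
  rough_sum q = zeta * \prod_(0 <= p < q | prime p) (1 - f p).
Proof.
elim: q => [|q IH]; first by rewrite big_geq // mulr1 rough_sum0.
by rewrite rough_sumS IH [in RHS]big_mkcond big_nat_recr //= -big_mkcond mulrA.
Qed.

Let rough_sum_ge1 q : 1 <= rough_sum q.
Proof.
apply: le_trans (psum_le_lim _ 2%N); rewrite psumS coprime1n f1 lerDr.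
by apply: sumr_ge0.
Qed.

(** An n > 1 without prime factor below q is at least q, so apart from n = 1
only the tail of the zeta series can contribute. *)
Let rough_sum_le q : rough_sum q <= 1 + (zeta - psum xpredT q).
Proof.
pose P n := coprime n (primorial q).
have head : psum P q <= 1.
  apply: (@le_trans _ _ (\sum_(0 <= n < q | n == 1%N) 1)); last first.
    by rewrite big_nat1_eq; case: ifP.
  rewrite /psum big_mkcond [leRHS]big_mkcond; apply: ler_sum_nat => n /= nq.
  case: ifP => [/coprime_primorialP n_q|_]; last by case: ifP.
  case: eqP => [->|n1]; first exact: f_le1.
  case: (posnP n) => [->|n_gt0]; first by rewrite -/(f 0) f0.
  have n_gt1 : (1 < n)%N by lia.
  have := n_q _ (pdiv_prime n_gt1) (leq_ltn_trans (pdiv_leq n_gt0) nq).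
  by rewrite pdiv_dvd.
apply: lim_psum => N; rewrite addrA lerBrDr.
set M := maxn q N.
apply: (@le_trans _ _ (1 + psum xpredT M)); last by rewrite lerD2l psum_le_lim.
apply: (@le_trans _ _ (psum P M + psum xpredT q)).
  by rewrite lerD2r; apply/psum_nd/leq_maxr.
rewrite /psum (@big_cat_nat _ _ _ q 0 M) ?leq_maxl //=.
rewrite [in leRHS](@big_cat_nat _ _ _ q 0 M) ?leq_maxl //=.
rewrite -addrA lerD // addrC lerD2l [leLHS]big_mkcond.
by apply: ler_sum => n _; case: ifP.
Qed.

(** By [1 - x <= exp (- x)], the bound [rough_sum q >= 1] gives
[exp (sum of p^-s over p < q) <= zeta]. *)
Let sum_primes_le : dirichlet_sum prime <= ln zeta.
Proof.
have zeta_gt0 : 0 < zeta by apply: lt_le_trans zeta_ge; rewrite invr_gt0.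
apply: lim_psum => q; rewrite -ler_expR lnK ?posrE //.
rewrite -[leLHS]mul1r -ler_pdivlMr ?expR_gt0 // -expRN.
apply: le_trans (rough_sum_ge1 q) _.
rewrite rough_sum_prod ler_pM2l // /psum -sumrN expR_sum.
apply: ler_prod => p p_pr; apply/andP; split; first by rewrite subr_ge0 f_le1.
exact: expR_ge1Dx.
Qed.

(** Choose q so large that the tail of the zeta series beyond q is at most 1:
then [rough_sum q <= 2], while the factors [1 - p^-s] are at least the
exponentials of [- (p^-s + 2 p^(-2s))]. The constant 3 is 2, for the squares,
plus a bound of [ln 2]. *)
Let sum_primes_ge : ln zeta <= dirichlet_sum prime + 3.
Proof.
have zeta_gt0 : 0 < zeta by apply: lt_le_trans zeta_ge; rewrite invr_gt0.
have [q q_large] : exists q, zeta - 1 <= psum xpredT q.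
  apply: contrapT => /forallNP small; suff : zeta <= zeta - 1 by lra.
  by apply: lim_psum => q; apply/ltW; rewrite ltNge; apply/negP/small.
have prod_ge : expR (- (dirichlet_sum prime + 2)) <=
    \prod_(0 <= p < q | prime p) (1 - f p).
  apply: (@le_trans _ _ (\prod_(0 <= p < q | prime p)
                          expR (- (f p + 2 * f p ^+ 2)))).
    rewrite -expR_sum ler_expR sumrN lerN2 big_split /= lerD ?psum_le_lim //.
    rewrite -mulr_sumr -[leRHS]mulr1 ler_pM2l //.
    apply: le_trans (sum_primes_invsq_le R q); apply: ler_sum => p _.
    by rewrite ler_sqr ?nnegrE ?invr_ge0 ?f_leV.
  apply: ler_prod => p p_pr; rewrite expR_ge0 expRN_le_1B // f_ge0 /=.
  apply: le_trans (f_leV _) _; rewrite lef_pV2 ?posrE ?ltr0n ?prime_gt0 //.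
  by rewrite ler_nat prime_gt1.
have : zeta * expR (- (dirichlet_sum prime + 2)) <= 2.
  apply: (@le_trans _ _ (rough_sum q)).
    by rewrite rough_sum_prod ler_pM2l.
  by have := rough_sum_le q; lra.
rewrite expRN ler_pdivrMr ?expR_gt0 // => zeta_le2.
have : ln zeta <= ln (2 * expR (dirichlet_sum prime + 2)).
  by rewrite ler_ln ?posrE ?mulr_gt0 ?expR_gt0.
rewrite lnM ?posrE ?expR_gt0 // expRK.
have := ln2_le1 R; lra.
Qed.

(** The constant is [m] for the missing primes, each contributing at most 1,
plus the error 3 of [sum_primes_ge]. *)
Lemma sum_cofinite_primes_bounds (Q : pred nat) (m : nat) :
  s < 2 -> subpred Q prime -> (forall p, prime p -> (m <= p)%N -> Q p) ->
  `|dirichlet_sum Q - ln (1 / t)| <= m%:R + 3.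
Proof.
move=> s_lt2 Q_prime prime_Q.
have tV_gt0 : 0 < t^-1 by rewrite invr_gt0.
have zeta_gt0 : 0 < zeta by apply: lt_le_trans zeta_ge.
have Q_le : dirichlet_sum Q <= dirichlet_sum prime.
  by apply: lim_psum => N; apply: le_trans (psum_le_lim _ N); apply: psum_sub.
have Q_ge : dirichlet_sum prime <= dirichlet_sum Q + m%:R.
  apply: lim_psum => N.
  apply: (@le_trans _ _ (psum Q N + psum (fun n => (n < m)%N) N)).
    rewrite /psum big_mkcond [X in X + _]big_mkcond [X in _ + X]big_mkcond.
    rewrite -big_split; apply: ler_sum => n _ /=.
    case: ifP => [n_pr|_]; last first.
      by apply: addr_ge0; case: ifP.
    case: (ltnP n m) => [_|mn]; last by rewrite (prime_Q _ n_pr mn) addr0.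
    by rewrite lerDr; case: ifP.
  apply: lerD; first exact: psum_le_lim.
  apply: (@le_trans _ _ (psum (fun n => (n < m)%N) (maxn m N))).
    exact/psum_nd/leq_maxr.
  rewrite /psum -(big_nat_widen 0 m (maxn m N) xpredT) ?leq_maxl //.
  apply: (@le_trans _ _ (\sum_(0 <= n < m) 1)).
    by apply: ler_sum => n _; apply: f_le1.
  by rewrite big_const_nat subn0 iter_addr_0.
have lnV : ln (1 / t) <= ln zeta by rewrite div1r ler_ln ?posrE ?zeta_ge.
have ln_zeta : ln zeta <= ln (1 / t) + 1.
  apply: (@le_trans _ _ (ln (2 * t^-1))).
    rewrite ler_ln ?posrE ?mulr_gt0 //; apply: le_trans zeta_le _.
    rewrite mulr_natl mulr2n lerD2r invf_ge1 // /t; lra.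
  by rewrite div1r lnM ?posrE // addrC lerD2l ln2_le1.
move: sum_primes_ge sum_primes_le (ler0n R m) => ? ? ?.
by rewrite ler_norml; apply/andP; split; lra.
Qed.

End DirichletSeries.

(** The numerator of the density quotient is within a constant of its
denominator, which tends to infinity. *)
Lemma density_cofinite_primes (R : realType) (Q : set nat) (m : nat) :
  (forall p, Q p -> prime p) -> (forall p, prime p -> (m <= p)%N -> Q p) ->
  density_quotient Q s @[s --> (1 : R)^'+] --> (1 : R).
Proof.
move=> Q_prime prime_Q; apply/cvgrPdist_le => e e_gt0.
pose C : R := m%:R + 3; have C_gt0 : 0 < C by rewrite ltr_wpDl.
(* For s < 1 + delta the denominator exceeds C / e. *)
pose delta := expR (- (C / e)).
near=> s.
have s_gt1 : 1 < s by near: s; apply: nbhs_right_gt.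
have s_lt : s < 1 + delta.
  by near: s; apply: nbhs_right_lt; rewrite ltrDl expR_gt0.
have delta_lt1 : delta < 1 by rewrite expR_lt1 oppr_lt0 divr_gt0.
have s_lt2 : s < 2 by lra.
have t_gt0 : 0 < s - 1 by rewrite subr_gt0.
have ln_large : C / e < ln (1 / (s - 1)).
  rewrite div1r lnV ?posrE // ltrNr -[ltRHS]expRK ltr_ln ?posrE ?expR_gt0 //.
  by rewrite -/delta; lra.
have ln_gt0 : 0 < ln (1 / (s - 1)).
  by apply: lt_trans ln_large; rewrite divr_gt0.
have bound : `|dirichlet_sum s (fun p => p \in Q) - ln (1 / (s - 1))| <= C.
  apply: sum_cofinite_primes_bounds => // [p|p p_pr mp]; rewrite inE.
    exact: Q_prime.
  exact: prime_Q.
rewrite /density_quotient -/(dirichlet_sum s _).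
set D := dirichlet_sum _ _ in bound *; set L := ln _ in bound ln_large ln_gt0 *.
have -> : 1 - D / L = - (D - L) / L by field; rewrite gt_eqF.
rewrite normrM normrN normfV [`|L|]gtr0_norm // ler_pdivrMr //.
by apply: le_trans bound _; rewrite mulrC -ler_pdivrMr // ltW.
Unshelve. all: by end_near.
Qed.

(** * The theorem *)

Theorem proposition1p8 (R : realType) :
  exists P'' : set nat,
    [/\ P'' `<=` primes_sl2,
        has_density R P'' &
        density R P'' >=
          1 / inf [set ((totient ((n * (2 * n - 1) * (2 * n + 1)) %/ 3))%:R : R)
                  | n in [set n : nat | odd n /\ (3 <= n)%N]]].
Proof.
pose Q : set nat := [set p | prime p /\ (19 <= p)%N].
have Q_cvg : density_quotient Q s @[s --> (1 : R)^'+] --> (1 : R).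
  by apply: (@density_cofinite_primes _ _ 19) => p; [case|split].
exists Q; split; first by move=> p [p_pr p_ge]; apply: primes_sl2_large.
  by apply/cvg_ex; exists 1.
rewrite /density (cvg_lim (@Rhausdorff R) Q_cvg) div1r.
set T := [set _ | _ in _].
have T_ge1 : 1 <= inf T.
  apply: lb_le_inf; first by eexists; exists 3%N.
  move=> _ [n [n_odd n_ge3] <-]; rewrite ler1n totient_gt0.
  rewrite divn_gt0 //; nia.
by rewrite invf_le1 // (lt_le_trans ltr01).
Qed.
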